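(* Let $\mathcal{X}\subset\mathbb{R}^d$ be a fixed finite data set with $n$ points and let $k<n$ be a fixed number of clusters. Let $\phi^{(1)},\phi^{(2)},\ldots$ be the final objective values returned by independent runs of $k$-means++ on $(\mathcal{X},k)$, and let $m$ be the number of distinct values of the objective $\phi$ attainable upon convergence of $k$-means++ on $(\mathcal{X},k)$. Then for every integer $r\geq 2$, the probability that run $r$ is an improvement satisfies $$P\!\left(\phi^{(r)} < \min\!\left(\phi^{(1)},\ldots,\phi^{(r-1)}\right)\right) \leq \frac{1}{r}\left(1-\left(\frac{1}{m}\right)^{r-1}\right).$$
   Context: Setting: $\mathcal{X}=\{x_1,\ldots,x_n\}\subset\mathbb{R}^d$ and $k<n$. A partition $(C_1,\ldots,C_k)$ of $\mathcal{X}$ has objective value $\phi=\sum_{l=1}^k\sum_{x_i\in C_l}\sum_{v=1}^d (x_{iv}-\mu_{lv})^2$, where $\mu_l$ is the component-wise mean of $C_l$. A run of $k$-means++ on $(\mathcal{X},k)$: the first initial centroid is chosen uniformly at random from $\mathcal{X}$; each subsequent centroid ($l=2,\ldots,k$) is chosen to be $x_i\in\mathcal{X}$ with probability $D(x_i)^2/\sum_{x_j\in\mathcal{X}}D(x_j)^2$, where $D(x)$ is the distance from $x$ to its nearest already-selected centroid. Then two steps are repeated until convergence: assign each $x_i$ to the cluster of its nearest centroid; update each centroid to the mean of its cluster. Given the initial centroids, this iteration is a deterministic procedure. The run returns the objective value $\phi$ of the final partition. Independent runs draw their initial centroids independently of one another. $\phi^{(i)}$ is the value returned by the $i$-th run.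 Run $r\geq 2$ is an improvement if $\phi^{(r)}<\min(\phi^{(1)},\ldots,\phi^{(r-1)})$. $m$ is the number of distinct values of $\phi$ attainable upon convergence of $k$-means++ on $(\mathcal{X},k)$. *)

(* Defs.v *)
From HB Require Import structures.
From mathcomp Require Import all_boot all_order all_algebra.
From mathcomp Require Import finmap ring.
From mathcomp Require Import all_classical all_reals all_analysis.

Set Implicit Arguments.
Unset Strict Implicit.
Unset Printing Implicit Defensive.

Import Order.TTheory GRing.Theory Num.Theory.

Local Open Scope classical_set_scope.
Local Open Scope ring_scope.

(* The norm [`| _ |] on ['rV_d] is the sup norm, so the Euclidean distance is
   written out. *)
Definition sqdist (R : realType) (d : nat) (y z : 'rV[R]_d) : R :=
  \sum_(v < d) (y 0 v - z 0 v) ^+ 2.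

Lemma sqdist_ge0 (R : realType) (d : nat) (y z : 'rV[R]_d) : 0 <= sqdist y z.
Proof. by apply: sumr_ge0 => v _; exact: sqr_ge0. Qed.

Definition dist (R : realType) (d : nat) (y z : 'rV[R]_d) : R :=
  Num.sqrt (sqdist y z).

(* A deterministic choice of a nearest centroid: the way ties are broken is left
   arbitrary.  The rows of the matrix are the centroids. *)
Record nearest_rule (R : realType) (k d : nat) := NearestRule {
  nearest :> 'M[R]_(k, d) -> 'rV[R]_d -> 'I_k ;
  nearestP : forall (c : 'M[R]_(k, d)) (y : 'rV[R]_d) (l : 'I_k),
    dist y (row (nearest c y) c) <= dist y (row l c) }.

Section KMeans.
Variables (R : realType) (n d k : nat).
Variable x : 'I_n -> 'rV[R]_d.

(* A partition of the data into k labelled clusters is given by the labels of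
   the points; a label may be unused. *)
Implicit Types (a : {ffun 'I_n -> 'I_k}) (c : 'M[R]_(k, d)).

Definition cluster a (l : 'I_k) : {set 'I_n} := [set i | a i == l].

Definition mean a (l : 'I_k) : 'rV[R]_d :=
  #|cluster a l|%:R^-1 *: \sum_(i in cluster a l) x i.

Definition objective a : R :=
  \sum_(l < k) \sum_(i in cluster a l) sqdist (x i) (mean a l).

Definition assign (near : nearest_rule R k d) c : {ffun 'I_n -> 'I_k} :=
  [ffun i => near c (x i)].

(* The centroid of a cluster that has become empty is kept unchanged. *)
Definition update c a : 'M[R]_(k, d) :=
  \matrix_(l < k) (if cluster a l == finset.set0 then row l c else mean a l).

Definition lloyd_step (near : nearest_rule R k d) c : 'M[R]_(k, d) :=
  update c (assign near c).

Definition cost a c : R := \sum_(i < n) sqdist (x i) (row (a i) c).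

Lemma cost_assign near a c : cost (assign near c) c <= cost a c.
Proof.
apply: ler_sum => i _; rewrite ffunE.
have := nearestP near c (x i) (a i).
by rewrite /dist ler_sqrt ?sqdist_ge0.
Qed.

Lemma cost_cluster a c :
  cost a c = \sum_(l < k) \sum_(i in cluster a l) sqdist (x i) (row l c).
Proof.
rewrite /cost (partition_big a xpredT) //=.
apply: eq_bigr => l _; apply: eq_big => [i|i /eqP <- //].
by rewrite inE.
Qed.

Lemma objectiveE a c : objective a = cost a (update c a).
Proof.
rewrite cost_cluster; apply: eq_bigr => l _; apply: eq_bigr => i il.
rewrite /update rowK ifF //; apply/negbTE/set0Pn; by exists i.
Qed.

Lemma cluster_cost a l (z : 'rV[R]_d) : cluster a l != finset.set0 ->
  \sum_(i in cluster a l) sqdist (x i) z =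
  \sum_(i in cluster a l) sqdist (x i) (mean a l)
  + #|cluster a l|%:R * sqdist (mean a l) z.
Proof.
move=> a0; rewrite /sqdist exchange_big /= [X in X + _]exchange_big /=.
rewrite mulr_sumr -big_split /=; apply: eq_bigr => v _.
have N0 : #|cluster a l|%:R != 0 :> R by rewrite pnatr_eq0 cards_eq0.
set m := mean a l 0 v; set N : R := _%:R in N0 *.
have sE : \sum_(i in cluster a l) x i 0 v = N * m.
  by rewrite /m /mean mxE summxE mulrA divff // mul1r.
have dev : \sum_(i in cluster a l) (x i 0 v - m) = 0.
  by rewrite big_split /= sE sumr_const mulNrn -mulr_natl subrr.
transitivity (\sum_(i in cluster a l)
   ((x i 0 v - m) ^+ 2 + (2 * (m - z 0 v) * (x i 0 v - m) + (m - z 0 v) ^+ 2))).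
  by apply: eq_bigr => i _; ring.
by rewrite big_split /= big_split /= -mulr_sumr dev mulr0 add0r sumr_const
  [in RHS]mulr_natl.
Qed.

Lemma objective_lt a c : update c a != c -> objective a < cost a c.
Proof.
move=> uc; have [l lc] : exists l, row l (update c a) != row l c.
  apply/existsP; apply: contraNT uc => /existsPn uc.
  by apply/eqP/row_matrixP => l; move: (uc l); rewrite negbK => /eqP.
rewrite cost_cluster /objective (bigD1 l) //= [ltRHS](bigD1 l) //=.
have le j : \sum_(i in cluster a j) sqdist (x i) (mean a j) <=
            \sum_(i in cluster a j) sqdist (x i) (row j c).
  have [->|a0] := eqVneq (cluster a j) finset.set0; first by rewrite !big_set0.
  by rewrite [leRHS]cluster_cost // lerDl mulr_ge0 ?ler0n ?sqdist_ge0.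
apply: ltr_leD; last by apply: ler_sum.
move: lc; rewrite rowK; case: ifPn => [_|a0 ml]; first by rewrite eqxx.
rewrite [ltRHS]cluster_cost // ltrDl mulr_gt0 //.
  by rewrite ltr0n card_gt0.
rewrite lt_neqAle sqdist_ge0 andbT eq_sym; apply: contraNneq ml => s0.
apply/eqP/rowP => v; apply/eqP; rewrite -subr_eq0 -sqrf_eq0; apply/eqP.
by move/psumr_eq0P : s0 => -> // w _; exact: sqr_ge0.
Qed.

(* The objective values of the successive partitions strictly decrease until the
   centroids are stationary, and there are finitely many partitions. *)
Lemma lloyd_converges (near : nearest_rule R k d) c : exists t : nat,
  lloyd_step near (iter t (lloyd_step near) c) == iter t (lloyd_step near) c.
Proof.
apply: contrapT => /forallNP nofix.
pose m t := iter t (lloyd_step near) c.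
pose A t := assign near (m t).
have dec t : objective (A t.+1) < objective (A t).
  apply: (@lt_le_trans _ _ (cost (A t.+1) (m t.+1))).
    by apply: objective_lt; apply/negP; exact: (nofix t.+1).
  by rewrite (objectiveE (A t) (m t)); exact: cost_assign.
have decr s t : (s < t)%N -> objective (A t) < objective (A s).
  elim: t => // t IH; rewrite ltnS leq_eqVlt => /predU1P[-> //|/IH].
  exact: lt_trans (dec t).
pose N := #|{ffun 'I_n -> 'I_k}|.
have /leq_card : injective (fun t : 'I_N.+1 => A t).
  move=> s t Ast; apply/val_inj => /=.
  by case: (ltngtP s t) => // /decr; rewrite Ast ltxx.
by rewrite card_ord ltnn.
Qed.

Definition lloyd_limit (near : nearest_rule R k d) c : 'M[R]_(k, d) :=
  iter (ex_minn (lloyd_converges near c)) (lloyd_step near) c.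

(* A seeding lists the indices of the initial centroids in order of selection. *)
Definition run_value (near : nearest_rule R k d) (s : k.-tuple 'I_n) : R :=
  objective (assign near
    (lloyd_limit near (\matrix_(l < k) x (tnth s l)))).

Definition dist_selected (i0 : 'I_n) (s : seq 'I_n) (y : 'rV[R]_d) : R :=
  \big[Num.min/dist y (x i0)]_(i <- s) dist y (x i).

(* The conditional probability that the next centroid is [x i], given the ones
   already selected. *)
Definition seed_step (selected : seq 'I_n) (i : 'I_n) : R :=
  if selected is i0 :: s then
    dist_selected i0 s (x i) ^+ 2
    / \sum_(j < n) dist_selected i0 s (x j) ^+ 2
  else n%:R^-1.

Definition seed_prob (s : k.-tuple 'I_n) : R :=
  \prod_(l < k) seed_step (take l s) (tnth s l).

Definition attainable_values (near : nearest_rule R k d) : seq R :=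
  undup [seq run_value near s | s <- enum {: k.-tuple 'I_n} & 0 < seed_prob s].

End KMeans.

(* Random elements of a finite type [S], with the discrete sigma-algebra. *)
Definition discrete_random_element (disp : measure_display)
    (Omega : measurableType disp) (S : finType) (X : Omega -> S) : Prop :=
  forall B : set S, measurable (X @^-1` B).

Definition mutually_independent (disp : measure_display)
    (Omega : measurableType disp) (R : realType) (P : probability Omega R)
    (I : choiceType) (D : set I) (S : finType) (X : I -> Omega -> S) : Prop :=
  forall (J : {fset I}) (B : I -> set S), [set` J] `<=` D ->
    P (\bigcap_(i in [set` J]) (X i @^-1` B i))
      = (\prod_(i <- J) P (X i @^-1` B i))%E.

(* Runs are numbered from 1; [seed r] is the seeding drawn by run [r]. *)
Definition kmeanspp_runs (R : realType) (n d k : nat) (x : 'I_n -> 'rV[R]_d)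
    (disp : measure_display) (Omega : measurableType disp)
    (P : probability Omega R) (seed : nat -> Omega -> k.-tuple 'I_n) : Prop :=
  [/\ forall r, (0 < r)%N -> discrete_random_element (seed r),
      forall r, (0 < r)%N -> forall s : k.-tuple 'I_n,
        P (seed r @^-1` [set s]) = (seed_prob x s)%:E &
      mutually_independent P [set r | (0 < r)%N] seed].

Definition improvement (Omega : Type) (R : realType) (phi : nat -> Omega -> R)
    (r : nat) : set Omega :=
  [set w | phi r w < \big[Num.min/phi 1%N w]_(2 <= i < r) phi i w].

(* Main.v *)
(* Let the attainable values v have probabilities p v, and let T v be the total
   weight of the values > v.  By independence the probability of improvement is
   the sum of the p v * T v ^ (r-1).  The binomial theorem gives
     r * p v * T v ^ (r-1) + p v ^ r <= (T v + p v) ^ r - T v ^ r  (r >= 2),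
   whose right-hand sides telescope to 1 along the sorted values, and the sum of
   the p v ^ r is at least m ^ (1-r) by convexity.  Probabilistically: r times
   the improvement probability is the probability that the minimum of r runs is
   attained only once, which excludes the event that all the runs agree. *)
Require Import Defs.
From mathcomp Require Import all_boot all_order all_algebra.
From mathcomp Require Import finmap ring lra.
From mathcomp Require Import all_classical all_reals all_analysis.

Import Order.TTheory GRing.Theory Num.Theory.

Local Open Scope classical_set_scope.
Local Open Scope ring_scope.

(** * Inequalities between powers and finite sums *)

(** Three terms of the binomial expansion are kept and the others, all nonnegative, dropped; for
    [r = 1] two of the three would coincide. In the induction, multiplying by [p + q] leaves the
    excess [q * P + r.+2%:R * (p * (p * Q))]. *)
Lemma exprDn_ge (R : realFieldType) (p q : R) (r : nat) :
  0 <= p -> 0 <= q -> (2 <= r)%N ->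
  p ^+ r + q ^+ r + r%:R * (p * q ^+ r.-1) <= (p + q) ^+ r.
Proof.
move=> p0 q0; case: r => [//|[//|r]] _.
elim: r => [|r IH]; first by rewrite /= (_ : _ + _ = (p + q) ^+ 2) //; ring.
rewrite [leRHS]exprS.
apply: (le_trans _ (ler_wpM2l (addr_ge0 p0 q0) IH)) => /=.
rewrite -subr_ge0.
set P := p ^+ r.+2; set Q := q ^+ r.+1.
have -> : (p + q) * (P + q ^+ r.+2 + r.+2%:R * (p * Q))
   - (p ^+ r.+3 + q ^+ r.+3 + r.+3%:R * (p * q ^+ r.+2))
   = q * P + r.+2%:R * (p * (p * Q)).
  by rewrite /P /Q !exprS -![_.+3%:R]natr1; ring.
have P0 : 0 <= P by exact: exprn_ge0.
have Q0 : 0 <= Q by exact: exprn_ge0.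
by apply: addr_ge0; repeat apply: mulr_ge0 => //.
Qed.

(* The graph of [p |-> p ^+ s.+1] lies above its tangent line at [a]. *)
Lemma exprn_tangent (R : realFieldType) (p a : R) (s : nat) :
  0 <= p -> 0 <= a ->
  s.+1%:R * (p * a ^+ s) - s%:R * a ^+ s.+1 <= p ^+ s.+1.
Proof.
move=> p0 a0; elim: s => [|s IH].
  by rewrite expr0 !mul1r mul0r subr0 mulr1.
rewrite [leRHS]exprS; apply: (le_trans _ (ler_wpM2l p0 IH)).
rewrite -subr_ge0; set A := a ^+ s.
have -> : p * (s.+1%:R * (p * A) - s%:R * a ^+ s.+1)
   - (s.+2%:R * (p * a ^+ s.+1) - s.+1%:R * a ^+ s.+2)
   = s.+1%:R * A * (p - a) ^+ 2.
  by rewrite /A !exprS -![_.+2%:R]natr1 -![_.+1%:R]natr1; ring.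
have A0 : 0 <= A by exact: exprn_ge0.
by apply: mulr_ge0; [exact: mulr_ge0|exact: sqr_ge0].
Qed.

(** Jensen's inequality for a power: the tangent bounds are summed at the average weight [a]. *)
Lemma sum_exprn_ge (R : realFieldType) (I : Type) (l : seq I) (p : I -> R)
    (s : nat) :
  (forall i, 0 <= p i) -> \sum_(i <- l) p i = 1 ->
  (size l)%:R^-1 ^+ s <= \sum_(i <- l) p i ^+ s.+1.
Proof.
move=> p0 p1; set a : R := _^-1.
have a0 : 0 <= a by rewrite invr_ge0 ler0n.
have la : (size l)%:R * a = 1.
  rewrite divff // pnatr_eq0; apply/eqP => /size0nil l0.
  by move/eqP: p1; rewrite l0 big_nil eq_sym oner_eq0.
apply: (@le_trans _ _
  (\sum_(i <- l) (s.+1%:R * (p i * a ^+ s) - s%:R * a ^+ s.+1))).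
  rewrite sumrB -mulr_sumr -mulr_suml p1 big_const_seq count_predT iter_addr_0.
  (* This form isolates the factor [1 - (size l)%:R * a], which vanishes by [la]. *)
  rewrite -natr1 (_ : _ - _ = a ^+ s * (1 + s%:R * (1 - (size l)%:R * a))).
    by rewrite la subrr mulr0 addr0 mulr1.
  by rewrite -[_ *+ size l]mulr_natl exprS; ring.
by apply: ler_sum => i _; exact: exprn_tangent.
Qed.

(** Induction on the list. The head [v] lies below all other entries, so its inner sum is the whole
    tail sum [S], while [v] enters none of the inner sums of the tail. Adding [exprDn_ge] for [p v]
    and [S] to the induction hypothesis cancels [S ^+ r]. *)
Lemma sorted_strict_min_sum (R : realFieldType) (l : seq R) (p : R -> R)
    (r : nat) :
  (forall v, 0 <= p v) -> (2 <= r)%N -> sorted <%R l ->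
  \sum_(v <- l) p v ^+ r
    + r%:R * \sum_(v <- l) p v * (\sum_(u <- l | v < u) p u) ^+ r.-1
  <= (\sum_(v <- l) p v) ^+ r.
Proof.
move=> p0 r2; elim: l => [|v l IH] sl.
  by rewrite !big_nil mulr0 addr0 exprn_ge0.
have vl : all (> v) l by move: sl; rewrite /= lt_path_sortedE => /andP[].
have {IH} := IH (path_sorted sl); rewrite !big_cons ltxx.
rewrite [in X in _ -> X](big_seq_cond (fun u => v < u)).
set S := \sum_(u <- l) p u.
rewrite [X in p v * X ^+ _](_ : _ = S); last first.
  rewrite /S [RHS]big_seq; apply: eq_bigl => u.
  by case ul : (u \in l) => //=; exact: (allP vl).
rewrite [X in _ -> _ + _ * (_ + X) <= _](_ : _ =
    \sum_(w <- l) p w * (\sum_(u <- l | w < u) p u) ^+ r.-1); last first.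
  rewrite !big_seq; apply: eq_bigr => w wl.
  by rewrite big_cons ltNge ltW //=; exact: (allP vl).
have S0 : 0 <= S by apply: sumr_ge0.
have := exprDn_ge R (p v) S r (p0 v) S0 r2.
lra.
Qed.

Lemma strict_min_sum (R : realFieldType) (l : seq R) (p : R -> R) (r : nat) :
  (forall v, 0 <= p v) -> (2 <= r)%N -> uniq l -> \sum_(v <- l) p v = 1 ->
  \sum_(v <- l) p v * (\sum_(u <- l | v < u) p u) ^+ r.-1
    <= r%:R^-1 * (1 - (size l)%:R^-1 ^+ (r - 1)).
Proof.
move=> p0 r2 ul p1.
have r0 : 0 < r%:R :> R by rewrite ltr0n (ltn_trans _ r2).
(* The goal becomes the sorted bound with the sum of the [p v ^+ r] replaced by its lower bound from
   [sum_exprn_ge]. *)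
rewrite mulrC ler_pdivlMr // mulrC lerBrDl.
have srt : sorted <%R (sort <=%R l) by rewrite sort_lt_sorted.
have perm : perm_eq l (sort <=%R l) by rewrite perm_sym perm_sort.
have := sorted_strict_min_sum R _ p r p0 r2 srt.
rewrite -!(perm_big _ perm) /= p1 expr1n.
under [X in _ * X]eq_bigr do rewrite -(perm_big _ perm) /=.
apply: le_trans; rewrite lerD2r.
have := sum_exprn_ge R _ l p r.-1 p0 p1.
by rewrite subn1 prednK // (ltn_trans _ r2).
Qed.

(** * Grouping outcomes by value *)

(** Discarding the values reached only with weight zero is harmless, since such [s] contribute
    nothing to either side; any other [s] is counted exactly once because [undup] lists [f s]
    once. *)
Lemma sum_group_values (R : realFieldType) (S : finType) (f p : S -> R)
    (A : pred R) (G : R -> R) :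
  (forall s, 0 <= p s) ->
  \sum_(s | A (f s)) p s * G (f s) =
  \sum_(v <- undup [seq f s | s <- enum S & 0 < p s] | A v)
    (\sum_(s | f s == v) p s) * G v.
Proof.
move=> p0; set l := undup _.
under [RHS]eq_bigr do rewrite mulr_suml.
rewrite (exchange_big_dep xpredT) //= big_mkcond /=.
apply: eq_bigr => s _.
have [ps|] := ltP 0 (p s); last first.
  rewrite le_eqVlt ltNge p0 orbF => /eqP ->; rewrite mul0r if_same.
  by rewrite big1 // => v _; rewrite mul0r.
have sl : f s \in l.
  by rewrite mem_undup; apply/mapP; exists s; rewrite // mem_filter ps mem_enum.
under eq_bigl do rewrite andbC eq_sym.
rewrite -big_filter_cond (_ : [seq v <- l | v == f s] = [:: f s]).
  by rewrite big_mkcond big_seq1.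
by rewrite filter_pred1_uniq // undup_uniq.
Qed.

Lemma lt_bigmin_seq (R : realDomainType) (I : Type) (l : seq I) (F : I -> R)
    (a v : R) :
  (v < \big[Num.min/a]_(i <- l) F i) = (v < a) && all (fun i => v < F i) l.
Proof.
elim: l => [|i l IH]; first by rewrite big_nil andbT.
by rewrite big_cons lt_min IH /= andbCA.
Qed.

(** * Probabilities of events as finite sums *)

Lemma probability_fin_partition (R : realType) (disp : measure_display)
    (Omega : measurableType disp) (P : probability Omega R) (S : finType)
    (A : pred S) (E : S -> set Omega) :
  (forall s, measurable (E s)) -> trivIset [set: S] E ->
  P (\bigcup_(s in [set s | A s]) E s) = (\sum_(s | A s) P (E s))%E.
Proof.
move=> mE tE; rewrite measure_fin_bigcup //.
- rewrite (fsbigE (enum A)) ?enum_uniq //=.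
  + by rewrite big_enum_cond; apply: eq_bigl => s; rewrite mem_setE unfold_in andbb.
  + by move=> s /=; rewrite mem_enum.
  + by move=> s /= As; rewrite mem_enum unfold_in As.
- exact: finite_finset.
- exact: sub_trivIset tE.
Qed.

Lemma probability_preimage (R : realType) (disp : measure_display)
    (Omega : measurableType disp) (P : probability Omega R) (S : finType)
    (X : Omega -> S) (p : S -> R) (A : pred S) :
  discrete_random_element X ->
  (forall s, P (X @^-1` [set s]) = (p s)%:E) ->
  P (X @^-1` [set s | A s]) = (\sum_(s | A s) p s)%:E.
Proof.
move=> mX pX; rewrite -sumEFin; under eq_bigr do rewrite -pX.
rewrite -probability_fin_partition.
- congr (P _); apply/seteqP; split=> w /=; first by move=> Aw; exists (X w).
  by case=> s /= As ->.
- by move=> s; exact: mX.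
- by move=> s t _ _ [w [/= -> ->]].
Qed.

(** The event is split according to the outcome [s] of run [r]; on each piece independence gives a
    product. *)
Lemma iid_improvement (R : realType) (disp : measure_display)
    (Omega : measurableType disp) (P : probability Omega R) (S : finType)
    (X : nat -> Omega -> S) (p f : S -> R) (r : nat) :
  (2 <= r)%N ->
  (forall i, (0 < i)%N -> discrete_random_element (X i)) ->
  (forall i, (0 < i)%N -> forall s, P (X i @^-1` [set s]) = (p s)%:E) ->
  mutually_independent P [set i | (0 < i)%N] X ->
  P (improvement (fun i w => f (X i w)) r) =
    (\sum_s p s * (\sum_(t | f s < f t) p t) ^+ r.-1)%:E.
Proof.
move=> r2 mX pX indX.
(* Run [r] has outcome [s], and every other run has a value strictly above [f s]. *)
pose B s i := if i == r then [set s] else [set t | f s < f t].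
pose E s := \bigcap_(i in [set i | i \in iota 1 r]) (X i @^-1` B s i).
have mE s : measurable (E s).
  apply: fin_bigcap_measurable => [|i].
    exact: finite_seq.
  by rewrite /= mem_iota => /andP[i0 _]; exact: mX.
have rE : r \in iota 1 r by rewrite mem_iota add1n ltnS leqnn (ltn_trans _ r2).
have ErX s w : E s w -> X r w = s by move=> /(_ r rE); rewrite /B /= eqxx.
have PE s : P (E s) = (p s * (\sum_(t | f s < f t) p t) ^+ r.-1)%:E.
  have [J JE] : exists J : {fset nat}, J =i iota 1 r.
    by exists (seq_fset tt (iota 1 r)) => i; rewrite seq_fsetE.
  have := indX J (B s).
  have -> : [set` J] = [set i | i \in iota 1 r].
    by apply/seteqP; split=> i /=; rewrite JE.
  move=> -> => [|i /=]; last by rewrite mem_iota => /andP[].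
  rewrite (perm_big (iota 1 r)) /=; last first.
    by apply: uniq_perm; rewrite ?fset_uniq ?iota_uniq.
  have -> : iota 1 r = rcons (iota 1 r.-1) r.
    have /prednK rE' := ltnW r2.
    by rewrite -[in LHS]rE' -[_.-1.+1]addn1 iotaD cats1 add1n rE'.
  rewrite big_rcons /= {2}/B eqxx pX ?(ltnW r2) // muleC EFinM; congr (_ * _)%E.
  rewrite big_seq (eq_bigr (fun=> (\sum_(t | f s < f t) p t)%:E)).
    by rewrite -big_seq prodEFin big_const_seq count_predT size_iota
      -Monoid.iteropE.
  move=> i; rewrite mem_iota add1n prednK ?(ltnW r2) // => /andP[i0 ir].
  rewrite /B ifN ?neq_ltn ?ir //.
  by apply: probability_preimage => [|t]; [exact: mX|exact: pX].
have -> : improvement (fun i w => f (X i w)) r =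
    \bigcup_(s in [set s | xpredT s]) E s.
  apply/seteqP; split=> w.
    rewrite /improvement /= lt_bigmin_seq => /andP[h1 /allP h].
    exists (X r w) => // i /=; rewrite mem_iota add1n ltnS /B => /andP[i0 ir].
    case: ifPn => [/eqP -> //|ni] /=.
    (* Run 1 is the default of the iterated minimum, outside its index range, hence the separate
       case. *)
    have [-> //|i1] := eqVneq i 1%N.
    apply: h; rewrite mem_index_iota ltn_neqAle eq_sym i1 i0 /=.
    by rewrite ltn_neqAle ni.
  case=> s _ Esw; rewrite /improvement /= lt_bigmin_seq (ErX _ _ Esw).
  have Ei i : (0 < i < r)%N -> f s < f (X i w).
    move=> /andP[i0 ir]; have := Esw i; rewrite /= mem_iota add1n ltnS i0 ltnW //.
    by rewrite /B ifN ?neq_ltn ?ir //; exact.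
  rewrite Ei //=; apply/allP => i; rewrite mem_index_iota => /andP[i2 ir].
  by apply: Ei; rewrite ir ltnW.
rewrite probability_fin_partition //.
  by rewrite -sumEFin; apply: eq_bigr => s _; exact: PE.
by move=> s t _ _ [w [/ErX <- /ErX <-]].
Qed.

Theorem theorem1 (R : realType) (n d k : nat) (x : 'I_n -> 'rV[R]_d)
    (x_inj : injective x) (k_gt0 : (0 < k)%N) (k_lt_n : (k < n)%N)
    (near : nearest_rule R k d)
    (disp : measure_display) (Omega : measurableType disp)
    (P : probability Omega R) (seed : nat -> Omega -> k.-tuple 'I_n)
    (runs : kmeanspp_runs x P seed)
    (phi : nat -> Omega -> R)
    (phiE : forall (i : nat) (w : Omega), phi i w = run_value x near (seed i w))
    (m : nat) (mE : m = size (attainable_values x near))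
    (r : nat) (r_ge2 : (2 <= r)%N) :
  (P (improvement phi r) <= (r%:R^-1 * (1 - m%:R^-1 ^+ (r - 1)))%:E)%E.
Proof.
case: runs => mseed pseed indep; subst m.
pose p := seed_prob x (k := k); pose f := run_value x near.
(* The weight of a seeding is nonnegative because it is a probability for run 1. *)
have p0 s : 0 <= p s by rewrite -lee_fin -(pseed 1%N).
have -> : phi = fun i w => f (seed i w).
  by apply/funext => i; apply/funext => w; exact: phiE.
rewrite (iid_improvement R disp Omega P _ seed p f r) // lee_fin.
pose l := attainable_values x near.
(* [q] is the law of the objective value of one run. *)
pose q v := \sum_(s | f s == v) p s.
have group (A : pred R) G :
    \sum_(s | A (f s)) p s * G (f s) = \sum_(v <- l | A v) q v * G v.
  exact: sum_group_values.
have group1 (A : pred R) : \sum_(s | A (f s)) p s = \sum_(v <- l | A v) q v.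
  by have := group A (fun=> 1); rewrite -!mulr_suml !mulr1.
(* The inner sums are grouped by value first, so that the outer summand depends on [s] only through
   [f s], apart from the factor [p s]. *)
rewrite (eq_bigr (fun s => p s * (\sum_(u <- l | f s < u) q u) ^+ r.-1));
  last by move=> s _; rewrite -group1.
rewrite (group xpredT (fun v => (\sum_(u <- l | v < u) q u) ^+ r.-1)).
apply: strict_min_sum => // [v||].
- by apply: sumr_ge0.
- exact: undup_uniq.
(* The total mass is 1 because the seeding of run 1 lies somewhere almost surely, with no
   computation on the products defining [seed_prob]. *)
rewrite -(group1 xpredT); apply: EFin_inj.
rewrite -(probability_preimage R disp Omega P _ (seed 1%N) p xpredT).
- by rewrite -(probability_setT P); congr (P _); apply/seteqP; split.
- exact: mseed.
- exact: pseed.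
Qed.
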